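(* Let $\alpha>0$, let $\theta>0$ be an acute angle, and suppose $\mu$ is a probability measure on $S^{n-1}$ satisfying the $\mathrm{ACW}(\theta,\alpha)$ condition. Let $x$ be a nonzero vector in $\mathbb{R}^n$, let $\delta > 0$, and let $x_0\in\mathbb{R}^n$ be an initial estimate to $x$ such that $\|x_0 - x\|_2 \leq \delta\|x\|_2$. Let $X_k$ denote the $k$-th step of the generalized randomized Kaczmarz method with respect to $\mu$ (with $X_0=x_0$). Let $\Omega$ be the event that for every integer $k \ge 0$, $X_k$ makes an angle less than $\theta$ with $x$. Then for every integer $k \ge 0$, $$\mathbb{E}\left[\|X_k-x\|_2^2\, 1_\Omega\right] \leq (1-\alpha/n)^k\|x_0-x\|_2^2.$$ Furthermore, $\mathbb{P}(\Omega^c) \leq (\delta/\sin\theta)^2$.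
   Context: For nonzero $x,z\in\mathbb{R}^n$ with angle $\omega$ between them, the set $W_{x,z} := \{v\in S^{n-1} : \operatorname{sign}(\langle v,x\rangle)\ne\operatorname{sign}(\langle v,z\rangle)\}$ is called a (spherical) wedge of angle $\omega$. A probability measure $\mu$ on $S^{n-1}$ satisfies the $\mathrm{ACW}(\theta,\alpha)$ condition if for every wedge $W\subset S^{n-1}$ of angle less than $\theta$, $\lambda_{\min}\left(\mathbb{E}\,aa^T - 4\,\mathbb{E}\,aa^T 1_W(a)\right) \ge \alpha/n$, where $a\sim\mu$ and $\lambda_{\min}$ is the smallest eigenvalue. Fix the target $x\in\mathbb{R}^n$. The generalized Kaczmarz projection with respect to $\mu$ is the random map $P=P_\mu$ given by $Pz := z+\eta a$, where $a\sim\mu$ and $\eta = \operatorname{sign}(\langle a,z\rangle)|\langle a,x\rangle| - \langle a,z\rangle$. The generalized randomized Kaczmarz method with respect to $\mu$ started at $x_0$ is $X_k := P_kP_{k-1}\cdots P_1x_0$, where $P_1,P_2,\dots$ are independent realizations of $P$. *)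

(* Defs.v *)
From HB Require Import structures.
From mathcomp Require Import all_boot all_order all_algebra.
From mathcomp Require Import all_classical all_reals all_analysis.

Set Implicit Arguments.
Unset Strict Implicit.
Unset Printing Implicit Defensive.

Import Order.TTheory GRing.Theory Num.Theory.
Import numFieldNormedType.Exports.

Local Open Scope classical_set_scope.
Local Open Scope ring_scope.

(* The sigma-algebra on R^n is the one generated by the coordinate maps, as the
   library does for [n.-tuple R]; it is the Borel sigma-algebra of R^n. *)
Definition colvec_display : measure_display.
Proof. exact: default_measure_display. Qed.

Section measurable_colvec.
Context {R : realType} (n : nat).

Let coord (i : 'I_n) (v : 'cV[R]_n) : R := v i 0.

Let colvec_set0 : g_sigma_preimage coord set0.
Proof. exact: sigma_algebra0. Qed.

Let colvec_setC A : g_sigma_preimage coord A -> g_sigma_preimage coord (~` A).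
Proof. exact: sigma_algebraC. Qed.

Let colvec_bigcup (F : _^nat) : (forall i, g_sigma_preimage coord (F i)) ->
  g_sigma_preimage coord (\bigcup_i (F i)).
Proof. exact: sigma_algebra_bigcup. Qed.

HB.instance Definition _ := @isMeasurable.Build colvec_display
  'cV[R]_n (g_sigma_preimage coord) colvec_set0 colvec_setC colvec_bigcup.

End measurable_colvec.

Section euclidean.
Context {R : realType} {n : nat}.
Implicit Types (u v x z : 'cV[R]_n).

Definition dotp u v : R := \sum_(i < n) u i 0 * v i 0.

(* The library norm on matrices is the sup norm, hence this one. *)
Definition norm2 v : R := Num.sqrt (dotp v v).

(* Only meaningful for nonzero u and v. *)
Definition angle u v : R := acos (dotp u v / (norm2 u * norm2 v)).

(* A probability measure on the sphere is encoded as one on R^n that gives the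
   sphere mass 1. *)
Definition sphere : set 'cV[R]_n := [set v | norm2 v = 1].

(* [Num.sg] takes the value 0 at 0. *)
Definition wedge x z : set 'cV[R]_n :=
  [set v | sphere v /\ Num.sg (dotp v x) != Num.sg (dotp v z)].

Definition is_wedge (W : set 'cV[R]_n) (omega : R) : Prop :=
  exists x z, [/\ x != 0, z != 0, angle x z = omega & W = wedge x z].

(* The zero vector makes no angle with anything. *)
Definition makes_angle_lt (theta : R) z x : Prop :=
  z != 0 /\ angle z x < theta.

(* The infimum is a minimum for symmetric matrices of positive size. *)
Definition lambda_min (A : 'M[R]_n) : R := inf [set l | eigenvalue A l].

Definition expectation_mx (mu : probability 'cV[R]_n R)
    (F : 'cV[R]_n -> 'M[R]_n) : 'M[R]_n :=
  \matrix_(i, j) fine 'E_mu[fun a => F a i j]%E.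

Definition ACW (mu : probability 'cV[R]_n R) (theta alpha : R) : Prop :=
  forall (W : set 'cV[R]_n) (omega : R), is_wedge W omega -> omega < theta ->
    lambda_min (expectation_mx mu (fun a => a *m a^T)
                - 4 *: expectation_mx mu (fun a => \1_W a *: (a *m a^T)))
      >= alpha / n%:R.

Definition kaczmarz_proj x (a z : 'cV[R]_n) : 'cV[R]_n :=
  let eta := Num.sg (dotp a z) * `|dotp a x| - dotp a z in z + eta *: a.

(* [a k] is the random direction used by the (k+1)-st projection. *)
Fixpoint kaczmarz {T : Type} x (x0 : 'cV[R]_n) (a : nat -> T -> 'cV[R]_n)
    (k : nat) (w : T) : 'cV[R]_n :=
  if k is k'.+1 then kaczmarz_proj x (a k' w) (kaczmarz x x0 a k' w) else x0.

End euclidean.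
Arguments sphere {R} n.

Section iid.
Context {d d' : measure_display} {T : measurableType d} {T' : measurableType d'}
  {R : realType} {P : probability T R}.

Definition mutually_independent (a : nat -> {RV P >-> T'}) : Prop :=
  forall (J : seq nat) (A : nat -> set T'), uniq J ->
    (forall j, measurable (A j)) ->
    P (\bigcap_(j in [set` J]) (a j @^-1` A j)) =
    (\prod_(j <- J) P (a j @^-1` A j))%E.

Definition identically_distributed (mu : probability T' R)
    (a : nat -> {RV P >-> T'}) : Prop :=
  forall k (A : set T'), measurable A -> distribution P (a k) A = mu A.

End iid.

(* Main.v *)
From HB Require Import structures.
Require Import Defs.
From mathcomp Require Import all_boot all_order all_algebra.
From mathcomp Require Import all_classical all_reals all_analysis.
From mathcomp Require Import measurable_realfun.
From mathcomp Require Import ring lra.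

(** Write [v = z - x] for the error of an estimate [z] and let [a] be a random
    unit vector. One projection removes the component of [v] along [a], except
    that when [<a,x>] and [<a,z>] have different signs it may add up to
    [4 <a,v>^2] (kaczmarz_proj_error). Averaging over [a], the squared error
    decreases by at least the quadratic form of
    [E aa^T - 4 E aa^T 1_W] at [v], where [W] is the wedge of [x] and [z]. If
    [z] makes an angle less than [theta] with [x], the ACW condition bounds the
    smallest eigenvalue of this matrix from below, hence, by the variational
    characterization of that eigenvalue (lambda_min_rayleigh), the squared error
    contracts on average by the factor [1 - alpha / n]
    (kaczmarz_proj_expectation).

    This is used only while the iterates stay in the cone of half-angle [theta]
    around [x], so the process is stopped when it first leaves the cone. The
    stopped process is still driven by [a_0, a_1, ...], and its state at time [k]
    is independent of [a_k], so that expectations at time [k + 1] can be computed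
    by integrating over [a_k] first (ge0_integral_recursion). Two consequences:

    - the squared error of the stopped process, restricted to the paths still in
      the cone at time [k], has expectation at most [(1 - alpha / n)^k |x0 - x|^2]
      (alive_sq_error_le). On [Omega] the stopped process is the Kaczmarz
      iteration and has not left the cone, which gives the first claim.

    - the squared error of the stopped process is a nonnegative supermartingale,
      and after leaving the cone it is at least [(|x| sin theta)^2]
      (not_close_dist). By the Markov inequality the probability of having left
      the cone by time [k] is at most [(|x0 - x| / (|x| sin theta))^2]
      (escape_probability_le); letting [k] go to infinity gives the second
      claim, since [|x0 - x| <= delta |x|]. *)

Set Implicit Arguments.
Unset Strict Implicit.
Unset Printing Implicit Defensive.

Import Order.TTheory GRing.Theory Num.Theory.
Import numFieldNormedType.Exports.

Local Open Scope classical_set_scope.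
Local Open Scope ring_scope.

(** * Euclidean space and the Rayleigh quotient *)

Section euclidean_lemmas.
Context {R : realType} {n : nat}.
Implicit Types (u v x z : 'cV[R]_n).

Lemma dotpC u v : dotp u v = dotp v u.
Proof. by apply: eq_bigr => i _; rewrite mulrC. Qed.

Lemma dotpDl u v x : dotp (u + v) x = dotp u x + dotp v x.
Proof. by rewrite -big_split; apply: eq_bigr => i _; rewrite mxE mulrDl. Qed.

Lemma dotpZl c u v : dotp (c *: u) v = c * dotp u v.
Proof. by rewrite mulr_sumr; apply: eq_bigr => i _; rewrite mxE mulrA. Qed.

Lemma dotpDr u v x : dotp x (u + v) = dotp x u + dotp x v.
Proof. by rewrite dotpC dotpDl !(dotpC x). Qed.

Lemma dotpZr c u v : dotp u (c *: v) = c * dotp u v.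
Proof. by rewrite dotpC dotpZl dotpC. Qed.

Lemma dotpNl u v : dotp (- u) v = - dotp u v.
Proof. by rewrite -scaleN1r dotpZl mulN1r. Qed.

Lemma dotpNr u v : dotp u (- v) = - dotp u v.
Proof. by rewrite dotpC dotpNl dotpC. Qed.

Definition dotpE := (dotpDl, dotpDr, dotpNl, dotpNr, dotpZl, dotpZr).

Lemma dotp0l v : dotp 0 v = 0.
Proof. by rewrite -(scale0r 0) dotpZl mul0r. Qed.

Lemma dotpp_ge0 v : 0 <= dotp v v.
Proof. by apply: sumr_ge0 => i _; rewrite -expr2 sqr_ge0. Qed.

Lemma dotpp_eq0 v : (dotp v v == 0) = (v == 0).
Proof.
apply/idP/eqP => [|->]; last by rewrite dotp0l.
rewrite psumr_eq0 => [/allP v0|i _]; last by rewrite -expr2 sqr_ge0.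
apply/matrixP => i j; rewrite ord1 mxE; apply/eqP.
by have := v0 i (mem_index_enum i); rewrite /= mulf_eq0 orbb.
Qed.

Lemma norm2_ge0 v : 0 <= norm2 v. Proof. exact: sqrtr_ge0. Qed.

Lemma norm2_sqr v : norm2 v ^+ 2 = dotp v v.
Proof. by rewrite sqr_sqrtr// dotpp_ge0. Qed.

Lemma norm2_gt0 v : (0 < norm2 v) = (v != 0).
Proof. by rewrite sqrtr_gt0 lt_neqAle dotpp_ge0 andbT eq_sym dotpp_eq0. Qed.

Lemma dotp_sqr_le u v : dotp u v ^+ 2 <= dotp u u * dotp v v.
Proof.
have [->|u0] := eqVneq u 0; first by rewrite !dotp0l mul0r expr2 mul0r.
have uu : 0 < dotp u u by rewrite -norm2_sqr exprn_gt0// norm2_gt0.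
have := dotpp_ge0 (dotp u u *: v - dotp u v *: u).
rewrite !dotpE (dotpC v u) => h.
rewrite -subr_ge0 -(pmulr_rge0 _ uu).
by apply: le_trans h _; rewrite le_eqVlt; apply/orP; left; apply/eqP; ring.
Qed.

Lemma dotp_norm_le u v : `|dotp u v| <= norm2 u * norm2 v.
Proof.
rewrite -ler_sqr ?nnegrE ?mulr_ge0 ?norm2_ge0//.
by rewrite exprMn !norm2_sqr real_normK ?num_real// dotp_sqr_le.
Qed.

Lemma dotp_trmx u v : dotp u v = (u^T *m v) 0 0.
Proof. by rewrite mxE; apply: eq_bigr => i _; rewrite !mxE. Qed.

Lemma dotp_mulmx (A : 'M[R]_n) u v : dotp u (A *m v) = dotp (A^T *m u) v.
Proof. by rewrite !dotp_trmx trmx_mul trmxK mulmxA. Qed.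

(** Completing the square: a nonnegative quadratic form vanishes only on the
    kernel of its matrix. The perturbation of [u] along [B u] by the step
    [- |B u|^2 / (1 + <B u, B (B u)>)] would otherwise make it negative. *)
Lemma psd_isotropic_kernel (B : 'M[R]_n) u :
  B^T = B -> (forall v, 0 <= dotp v (B *m v)) -> dotp u (B *m u) = 0 ->
  B *m u = 0.
Proof.
move=> symB psdB u0; apply/eqP; rewrite -dotpp_eq0.
set w := B *m u; set c := dotp w w; set e := dotp w (B *m w).
have e0 : 0 <= e := psdB w.
have c0 : 0 <= c := dotpp_ge0 w.
have := psdB (u - (c / (1 + e)) *: w).
rewrite mulmxBr -scalemxAr !dotpE u0 dotp_mulmx symB -/w -/e -/c.
move=> h; rewrite eq_le c0 andbT leNgt; apply/negP => c1.
have e1 : 0 < 1 + e by rewrite ltr_pwDl.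
have : (c / (1 + e)) * c < 0 -> False.
  by apply/negP; rewrite -leNgt mulr_ge0// divr_ge0// ltW.
apply; set t := c / (1 + e) in h *.
have tc : c = t * (1 + e) by rewrite /t divfK// gt_eqF.
have t0 : 0 < t by rewrite divr_gt0.
have te : t * e = c - t by rewrite tc; ring.
have tt : 0 < t * t by rewrite mulr_gt0.
by move: h; rewrite te; lra.
Qed.

(** The quadratic form is continuous and the unit sphere compact; homogeneity
    extends the inequality from the sphere to the whole space. *)
Lemma rayleigh_minimizer (A : 'M[R]_n) : (0 < n)%N ->
  exists2 u, dotp u u = 1 &
    forall v, dotp u (A *m u) * dotp v v <= dotp v (A *m v).
Proof.
move=> n0; pose S : set 'rV[R]_n := [set v | dotp v^T v^T = 1].
pose q (v : 'rV[R]_n) := dotp v^T (A *m v^T).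
have ctr i : continuous (fun v : 'rV[R]_n => v 0 i) by exact: coord_continuous.
have csum (I : Type) (s : seq I) (f : I -> 'rV[R]_n -> R) :
    (forall i, continuous (f i)) ->
    continuous (fun v : 'rV[R]_n => \sum_(i <- s) f i v).
  move=> cf; elim: s => [|i s IH] v.
    by under eq_fun do rewrite big_nil; exact: cst_continuous.
  under eq_fun do rewrite big_cons.
  by apply: continuousD; [exact: cf|exact: IH].
have cdot : continuous (fun v : 'rV[R]_n => dotp v^T v^T).
  apply: csum => i v; under eq_fun do rewrite !mxE.
  by apply: continuousM; exact: ctr.
have cq : continuous q.
  apply: (csum _ _ _) => i.
  have -> : (fun v : 'rV[R]_n => v^T i 0 * (A *m v^T) i 0) =
      (fun v : 'rV[R]_n => v 0 i * \sum_j A i j * v 0 j).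
    apply/funext => v; rewrite !mxE; congr (_ * _).
    by apply: eq_bigr => j _; rewrite mxE.
  move=> v; apply: continuousM; first exact: ctr.
  apply: csum => j {}v; apply: continuousM; first exact: cst_continuous.
  exact: ctr.
have cS : compact S.
  apply: bounded_closed_compact.
    exists 1; split=> // M M1 v Sv; apply: le_trans (ltW M1).
    rewrite [`|v|]mx_normrE.
    apply: bigmax_le => //= -[i j] _ /=; rewrite (ord1 i).
    rewrite -(@ler_sqr _ `|_| 1) ?nnegrE// real_normK ?num_real// expr1n -Sv.
    rewrite /dotp (bigD1 j)//= mxE -expr2 lerDl.
    by apply: sumr_ge0 => k _; rewrite mxE -expr2 sqr_ge0.
  by apply: (@preimage_closed _ _ (fun v : 'rV[R]_n => dotp v^T v^T) [set 1]) => //.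
have S0 : S !=set0.
  exists (delta_mx 0 (Ordinal n0)); rewrite /S /= /dotp (bigD1 (Ordinal n0))//=.
  rewrite !mxE !eqxx/= mulr1 big1 ?addr0// => i i0.
  by rewrite !mxE (negbTE i0) mulr0.
have [c cS1 cmin] := EVT_min_rV S0 cS (continuous_subspaceT cq).
rewrite inE /= in cS1.
exists c^T => // v; have [->|v0] := eqVneq v 0.
  by rewrite !dotp0l mulr0.
have nv : 0 < norm2 v by rewrite norm2_gt0.
have := cmin ((norm2 v)^-1 *: v)^T.
rewrite inE /S /= /q !trmxK -scalemxAr !dotpE -norm2_sqr.
have -> : (norm2 v)^-1 * ((norm2 v)^-1 * norm2 v ^+ 2) = 1.
  by field; rewrite gt_eqF.
move=> /(_ erefl); rewrite mulrA -invfM -expr2 mulrC.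
by rewrite ler_pdivlMr// exprn_gt0.
Qed.

(** The minimum of the Rayleigh quotient is attained, and a minimizer is an
    eigenvector; the infimum defining [lambda_min] is therefore at most, and in
    fact equal to, that minimum. *)
Lemma lambda_min_rayleigh (A : 'M[R]_n) v : A^T = A ->
  lambda_min A * dotp v v <= dotp v (A *m v).
Proof.
move=> symA; have [n0|n0] := posnP n.
  suff -> : v = 0 by rewrite !dotp0l mulr0.
  by apply/matrixP => i; have := ltn_ord i; rewrite {2}n0.
have [u u1 umin] := rayleigh_minimizer A n0.
set m := dotp u (A *m u) in umin.
suff lm : lambda_min A <= m.
  by apply: le_trans (umin v); rewrite ler_wpM2r// dotpp_ge0.
have Au : A *m u = m *: u.
  apply/eqP; rewrite -subr_eq0; apply/eqP.
  have -> : A *m u - m *: u = (A - m%:M) *m u by rewrite mulmxBl mul_scalar_mx.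
  apply: psd_isotropic_kernel => [|w|].
  - by rewrite linearB/= tr_scalar_mx symA.
  - by rewrite mulmxBl mul_scalar_mx !dotpE subr_ge0 umin.
  - by rewrite mulmxBl mul_scalar_mx !dotpE u1 mulr1 subrr.
apply: ge_inf.
  exists m => l /eigenvalueP [w wA w0].
  have Aw : A *m w^T = l *: w^T by rewrite -[A]symA -trmx_mul wA linearZ.
  have := umin w^T; rewrite Aw dotpE ler_pM2r//.
  by rewrite -norm2_sqr exprn_gt0// norm2_gt0 trmx_eq0.
apply/eigenvalueP; exists u^T; first by rewrite -[A]symA -trmx_mul Au linearZ.
by rewrite trmx_eq0 -dotpp_eq0 u1 oner_eq0.
Qed.

End euclidean_lemmas.

(** * Angles and one Kaczmarz projection *)

Section angle_and_projection.
Context {R : realType} {n : nat}.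
Implicit Types (a v x z : 'cV[R]_n).

(** The angle condition cleared of [acos] and of division. In this form it is a
    measurable condition on [z], and it fails at [z = 0]. *)
Definition close_angle (theta : R) x z : bool :=
  cos theta * (norm2 z * norm2 x) < dotp z x.

Lemma angleC x z : angle x z = angle z x.
Proof. by rewrite /angle dotpC (mulrC (norm2 x)). Qed.

Lemma makes_angle_ltE (theta : R) x z : 0 < theta -> theta < pi / 2 ->
  x != 0 -> makes_angle_lt theta z x <-> close_angle theta x z.
Proof.
move=> t0 tpi x0; rewrite /close_angle.
have key : z != 0 ->
    (angle z x < theta) = (cos theta * (norm2 z * norm2 x) < dotp z x).
  move=> z0; have nn : 0 < norm2 z * norm2 x by rewrite mulr_gt0 ?norm2_gt0.
  have tp : theta \in `[0, pi] by rewrite in_itv/=; have := @pi_gt0 R; lra.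
  (* Cauchy-Schwarz puts the cosine in [-1, 1], where [cos] inverts [acos] *)
  have : `|dotp z x / (norm2 z * norm2 x)| <= 1.
    by rewrite normrM normfV (gtr0_norm nn) ler_pdivrMr// mul1r dotp_norm_le.
  rewrite ler_norml => u1.
  have [/andP[a0 api] ca] := acos_def u1.
  by rewrite -ltr_cos ?in_itv/= ?a0// ca ltr_pdivlMr.
split=> [[z0]|h]; first by rewrite key.
have z0 : z != 0.
  apply: contraTneq h => ->; rewrite dotp0l -leNgt.
  by rewrite /norm2 dotp0l sqrtr0 mul0r mulr0.
by split=> //; rewrite key.
Qed.

(** The complement of the cone of half-angle [theta] around [x] stays at distance
    [|x| sin theta] from [x]: complete the square in [|z|]. *)
Lemma not_close_dist (theta : R) x z : ~~ close_angle theta x z ->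
  (norm2 x * sin theta) ^+ 2 <= norm2 (z - x) ^+ 2.
Proof.
rewrite /close_angle -leNgt norm2_sqr !dotpE (dotpC x z) -!norm2_sqr => h.
have := sqr_ge0 (norm2 z - norm2 x * cos theta).
have := cos2Dsin2 theta; set c := cos theta in h *; set s := sin theta.
set p := norm2 z in h *; set q := norm2 x in h *; move=> cs pq.
have -> : (q * s) ^+ 2 = q ^+ 2 * (1 - c ^+ 2) by rewrite -cs; ring.
nra.
Qed.

(** The new error is the old one with its component along [a] replaced by
    [sg<a,z> |<a,x>| - <a,x>]. The replacement is zero when the signs of [<a,x>]
    and [<a,z>] agree; otherwise it is at most [2 |<a,x>|], and the signs being
    different [|<a,x>| <= |<a,z> - <a,x>|]. *)
Lemma kaczmarz_proj_error a x z : norm2 a = 1 ->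
  norm2 (kaczmarz_proj x a z - x) ^+ 2 <= norm2 (z - x) ^+ 2 -
    (dotp a (z - x) ^+ 2 - 4 * (\1_(wedge x z) a * dotp a (z - x) ^+ 2)).
Proof.
move=> a1; have aa : dotp a a = 1 by rewrite -norm2_sqr a1 expr1n.
rewrite /kaczmarz_proj.
set s := dotp a z; set t := dotp a x; set e := _ - s.
have -> : z + e *: a - x = (z - x) + e *: a by rewrite addrAC.
have av : dotp a (z - x) = s - t by rewrite !dotpE.
rewrite !norm2_sqr; move: (z - x) av => v av.
have -> : dotp (v + e *: a) (v + e *: a) =
    dotp v v - ((s - t) ^+ 2 - (Num.sg s * `|t| - t) ^+ 2).
  by rewrite !dotpE (dotpC v a) av aa /e; ring.
rewrite av lerD2l lerN2 lerD2l lerN2.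
have [W|W] := pselect (wedge x z a); rewrite indicE; last first.
  rewrite memNset// mul0r mulr0.
  have -> : Num.sg s = Num.sg t.
    by apply/eqP/negPn/negP => st; apply: W; split=> //; rewrite eq_sym.
  by rewrite -numEsg subrr expr0n.
rewrite mem_set// mul1r; move: W => [_]; rewrite -/s -/t.
case: (ltrgtP s 0) => [s0|s0|->]; case: (ltrgtP t 0) => [t0|t0|->];
  rewrite ?(ltr0_sg s0) ?(gtr0_sg s0) ?(ltr0_sg t0) ?(gtr0_sg t0) ?sgr0
    ?(ltr0_norm t0) ?(gtr0_norm t0) ?normr0 ?eqxx// => _; nra.
Qed.

End angle_and_projection.

(** * Measurability *)

Section measurability.
Context {R : realType} {n : nat} {d : measure_display} {T : measurableType d}.
Implicit Types (f g h : T -> 'cV[R]_n) (x : 'cV[R]_n).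

Lemma measurable_coord (i : 'I_n) :
  measurable_fun setT (fun v : 'cV[R]_n => v i 0).
Proof.
move=> _ B mB; rewrite setTI; apply: sub_sigma_algebra.
by rewrite (bigD1 i)//=; left; exists B => //; rewrite setTI.
Qed.

(** It suffices to check preimages of the generators of the sigma-algebra of
    [R^n], that is, of sets constraining a single coordinate. *)
Lemma measurable_colP f :
  measurable_fun setT f <-> forall i, measurable_fun setT (fun t => f t i 0).
Proof.
split=> [mf i|mf]; first exact: (measurableT_comp (measurable_coord i)).
apply: (measurability (\big[setU/set0]_(i < n)
  preimage_set_system setT (fun v : 'cV[R]_n => v i 0) measurable)) => //.
move=> _ [B + <-]; rewrite setTI.
elim/big_rec : _ => [//|i C _ IH [[D mD <-]|//]].
by rewrite setTI -[X in measurable X]setTI; exact: mf.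
Qed.

Lemma measurable_dotp f g : measurable_fun setT f -> measurable_fun setT g ->
  measurable_fun setT (fun t => dotp (f t) (g t)).
Proof.
move=> /measurable_colP mf /measurable_colP mg.
by apply: measurable_sum => i; exact: measurable_funM.
Qed.

Lemma measurable_sqrt_comp (u : T -> R) : measurable_fun setT u ->
  measurable_fun setT (fun t => Num.sqrt (u t)).
Proof.
move=> mu; apply: (@measurableT_comp _ _ _ _ _ _ (@Num.sqrt R)) => //.
by apply: continuous_measurable_fun; exact: sqrt_continuous.
Qed.

Lemma measurable_norm2 f : measurable_fun setT f ->
  measurable_fun setT (fun t => norm2 (f t)).
Proof. by move=> mf; apply: measurable_sqrt_comp; exact: measurable_dotp. Qed.

Lemma measurable_sg (u : T -> R) : measurable_fun setT u ->
  measurable_fun setT (fun t => Num.sg (u t)).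
Proof.
move=> mu; rewrite (_ : (fun t => _) =
    (fun t => if 0 < u t then 1 else if u t < 0 then -1 else 0 : R)); last first.
  by apply/funext => t; case: ltrgtP => u0;
    [rewrite gtr0_sg|rewrite ltr0_sg|rewrite -u0 sgr0].
by do 2!(apply: measurable_fun_ifT => //; first exact: measurable_fun_ltr).
Qed.

Lemma measurable_dist2 f x : measurable_fun setT f ->
  measurable_fun setT (fun t => norm2 (f t - x) ^+ 2).
Proof.
move=> /measurable_colP mf; apply: measurable_funX; apply: measurable_norm2.
apply/measurable_colP => i; under eq_fun do rewrite !mxE.
exact: measurable_funB.
Qed.

Lemma measurable_kaczmarz_proj x f g :
  measurable_fun setT f -> measurable_fun setT g ->
  measurable_fun setT (fun t => kaczmarz_proj x (f t) (g t)).
Proof.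
move=> mf mg; apply/measurable_colP => i; rewrite /kaczmarz_proj.
under eq_fun do rewrite !mxE.
apply: measurable_funD; first by move: i; exact/measurable_colP.
apply: measurable_funM; last by move: i; exact/measurable_colP.
apply: measurable_funB; last exact: measurable_dotp.
apply: measurable_funM; first by apply: measurable_sg; exact: measurable_dotp.
by apply: measurableT_comp => //; exact: measurable_dotp.
Qed.

Lemma measurable_close_angle (theta : R) x f : measurable_fun setT f ->
  measurable_fun setT (fun t => close_angle theta x (f t)).
Proof.
move=> mf; apply: measurable_fun_ltr; last exact: measurable_dotp.
apply: measurable_funM => //; apply: measurable_funM => //.
exact: measurable_norm2.
Qed.

Lemma measurable_eq_set (u v : T -> R) : measurable_fun setT u ->
  measurable_fun setT v -> measurable [set t | u t = v t].
Proof.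
move=> mu mv.
have -> : [set t | u t = v t] = setT `&` (u \- v) @^-1` [set 0].
  rewrite setTI; apply/seteqP; split=> t /= => [->|/eqP]; first by rewrite subrr.
  by rewrite subr_eq0 => /eqP.
by apply: measurable_funB => //; exact: measurable_set1.
Qed.

End measurability.

Lemma measurable_sphere {R : realType} {n : nat} : measurable (@sphere R n).
Proof. by apply: measurable_eq_set => //; exact: measurable_norm2. Qed.

Lemma measurable_wedge {R : realType} {n : nat} (x z : 'cV[R]_n) :
  measurable (wedge x z).
Proof.
have -> : wedge x z = @sphere R n `&`
    ~` [set v | Num.sg (dotp v x) = Num.sg (dotp v z)].
  by apply/seteqP; split=> v [Sv] /eqP.
apply: measurableI; first exact: measurable_sphere.
apply: measurableC; apply: measurable_eq_set; apply: measurable_sg;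
  exact: measurable_dotp.
Qed.

(** * Expected error after one projection *)

Lemma integral_full_measure {R : realType} {d} {T : measurableType d}
    (mu : probability T R) (S : set T) (f : T -> \bar R) :
  measurable S -> mu S = 1%E -> measurable_fun setT f ->
  (\int[mu]_t f t = \int[mu]_(t in S) f t)%E.
Proof.
move=> mS S1 mf; rewrite [RHS]integral_mkcond; apply: ae_eq_integral => //.
  by apply/(measurable_restrictT _ mS); exact: measurable_funTS.
exists (~` S); split; first exact: measurableC.
  by apply: etrans (probability_setC mu mS) _; rewrite S1 subee.
move=> t /=; apply: contra_not => St _; rewrite /patch mem_set//.
Qed.

Section one_step_expectation.
Context {R : realType} {n : nat} (mu : probability 'cV[R]_n R).
Hypothesis mu_sphere : mu (sphere n) = 1%E.
Implicit Types (a v x z : 'cV[R]_n).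
Local Notation S := (@sphere R n).

Lemma sphere_bounded_integrable (f : 'cV[R]_n -> R) (M : R) :
  measurable_fun setT f -> (forall a, S a -> `|f a| <= M) ->
  mu.-integrable S (EFin \o f).
Proof.
move=> mf fM; apply: measurable_bounded_integrable.
- exact: measurable_sphere.
- by rewrite -ge0_fin_numE// fin_num_measure//; exact: measurable_sphere.
- exact: measurable_funTS.
- exists M; split; first by rewrite num_real.
  by move=> N MN a Sa; apply: le_trans (fM _ Sa) (ltW MN).
Qed.

Lemma sphere_coord_le a (i : 'I_n) : S a -> `|a i 0| <= 1.
Proof.
move=> a1; rewrite -(@ler_sqr _ `|_| 1) ?nnegrE// real_normK ?num_real//.
rewrite expr1n -(expr1n _ 2) -a1 norm2_sqr /dotp (bigD1 i)//= -expr2 lerDl.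
by apply: sumr_ge0 => k _; rewrite -expr2 sqr_ge0.
Qed.

Lemma sphere_dotp_le a v : S a -> dotp a v ^+ 2 <= dotp v v.
Proof.
by move=> a1; rewrite (le_trans (dotp_sqr_le _ _))// -norm2_sqr a1 expr1n mul1r.
Qed.

(** The matrix [E aa^T 1_W]. The integral is restricted to the sphere, which has
    full measure, because the entries are bounded there and hence integrable. *)
Definition second_moment (W : set 'cV[R]_n) : 'M[R]_n :=
  \matrix_(i, j) \int[mu]_(a in S) (\1_W a * (a i 0 * a j 0)).

Lemma second_moment_tr W : (second_moment W)^T = second_moment W.
Proof.
apply/matrixP => i j; rewrite !mxE; apply: eq_Rintegral => a _.
by rewrite (mulrC (a j 0)).
Qed.

Lemma integrable_second_moment W i j : measurable W ->
  mu.-integrable S (EFin \o (fun a : 'cV[R]_n => \1_W a * (a i 0 * a j 0))).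
Proof.
move=> mW; apply: (@sphere_bounded_integrable _ 1).
  apply: measurable_funM; first exact: measurable_indic.
  by apply: measurable_funM; exact: measurable_coord.
move=> a Sa; rewrite !normrM -[1]mulr1 ler_pM//.
  by rewrite indicE; case: (_ \in _); rewrite ?normr1 ?normr0.
by rewrite -[1]mulr1 ler_pM// sphere_coord_le.
Qed.

Lemma Rintegral_sphere_sum (I : Type) (s : seq I) (f : I -> 'cV[R]_n -> R) :
  (forall i, mu.-integrable S (EFin \o f i)) ->
  \int[mu]_(a in S) (\sum_(i <- s) f i a) =
  \sum_(i <- s) \int[mu]_(a in S) f i a.
Proof.
move=> fi; elim: s => [|i s IH].
  rewrite (@eq_Rintegral _ _ _ mu S (cst 0)); last by move=> a _; rewrite big_nil.
  by rewrite Rintegral_cst ?mul0r ?big_nil//; exact: measurable_sphere.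
rewrite (@eq_Rintegral _ _ _ mu S
  (fun a => f i a + \sum_(j <- s) f j a)); last first.
  by move=> a _; rewrite big_cons.
rewrite RintegralD//; [by rewrite big_cons IH|exact: measurable_sphere|].
rewrite (_ : _ \o _ = fun a => \sum_(j <- s) (f j a)%:E)%E.
  by apply: (integrable_sum measurable_sphere) => j _; exact: fi.
by apply/funext => a; rewrite /= sumEFin.
Qed.

Lemma second_moment_quadratic W v : measurable W ->
  dotp v (second_moment W *m v) = \int[mu]_(a in S) (\1_W a * dotp a v ^+ 2).
Proof.
move=> mW.
have mS := @measurable_sphere R n.
rewrite (@eq_Rintegral _ _ _ mu S (fun a => \sum_(p : 'I_n * 'I_n)
    (v p.1 0 * v p.2 0) * (\1_W a * (a p.1 0 * a p.2 0)))); last first.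
  move=> a _; rewrite expr2 /dotp big_distrlr/= pair_big/= mulr_sumr.
  by apply: eq_bigr => p _; ring.
rewrite Rintegral_sphere_sum; last first.
  move=> p; exact: (integrableZl mS (v p.1 0 * v p.2 0)
    (integrable_second_moment p.1 p.2 mW)).
rewrite /dotp; under eq_bigr => i _ do rewrite mxE mulr_sumr.
rewrite pair_big/=; apply: eq_bigr => p _.
rewrite RintegralZl ?mxE//; first by ring.
exact: integrable_second_moment.
Qed.

Lemma expectation_outer_sub_wedge W : measurable W ->
  expectation_mx mu (fun a => a *m a^T)
    - 4 *: expectation_mx mu (fun a => \1_W a *: (a *m a^T)) =
  second_moment setT - 4 *: second_moment W.
Proof.
move=> mW; have mS := @measurable_sphere R n.
have outer (a : 'cV[R]_n) i j : (a *m a^T) i j = a i 0 * a j 0.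
  by rewrite mxE big_ord1 mxE.
have mout i j : measurable_fun setT (fun a : 'cV[R]_n => a i 0 * a j 0).
  by apply: measurable_funM; exact: measurable_coord.
apply/matrixP => i j; rewrite !mxE; congr (_ - 4 * _).
  rewrite unlock (integral_full_measure mS mu_sphere); last first.
    apply/measurable_EFinP; under eq_fun do rewrite outer.
    exact: mout.
  by apply: eq_Rintegral => a _; rewrite outer indicT mul1r.
rewrite unlock (integral_full_measure mS mu_sphere); last first.
  apply/measurable_EFinP; under eq_fun do rewrite mxE outer.
  by apply: measurable_funM => //; exact: measurable_indic.
by apply: eq_Rintegral => a _; rewrite mxE outer.
Qed.

Variables (theta alpha : R) (x : 'cV[R]_n).
Hypotheses (theta_gt0 : 0 < theta) (theta_acute : theta < pi / 2)
  (mu_ACW : ACW mu theta alpha) (x_neq0 : x != 0).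

(** The ACW condition in the form in which it is used: the integrand on the right
    is the one-step decrease of the squared error in kaczmarz_proj_error. *)
Lemma ACW_quadratic z : close_angle theta x z ->
  alpha / n%:R * norm2 (z - x) ^+ 2 <=
  \int[mu]_(a in S) (dotp a (z - x) ^+ 2 -
    4 * (\1_(wedge x z) a * dotp a (z - x) ^+ 2)).
Proof.
move=> zx; have [z0 zxt] : makes_angle_lt theta z x.
  exact/(makes_angle_ltE _ theta_gt0 theta_acute x_neq0).
have mW := measurable_wedge x z; have mS := @measurable_sphere R n.
have : lambda_min (second_moment setT - 4 *: second_moment (wedge x z))
    >= alpha / n%:R.
  rewrite -expectation_outer_sub_wedge//; apply: (mu_ACW (omega := angle x z)).
    by exists x, z.
  by rewrite angleC.
have sym : (second_moment setT - 4 *: second_moment (wedge x z))^T =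
    second_moment setT - 4 *: second_moment (wedge x z).
  by rewrite linearB linearZ/= !second_moment_tr.
move=> lm; rewrite norm2_sqr; move: (z - x) => v.
apply: le_trans (_ : _ <= lambda_min _ * dotp v v) _.
  by rewrite ler_wpM2r ?dotpp_ge0//; exact: lm.
apply: le_trans (lambda_min_rayleigh _ sym) _.
rewrite mulmxBl -scalemxAl !dotpE !second_moment_quadratic//.
have int_sq W : measurable W ->
    mu.-integrable S (EFin \o (fun a => \1_W a * dotp a v ^+ 2)).
  move=> {}mW; apply: (@sphere_bounded_integrable _ (dotp v v)).
    apply: measurable_funM; first exact: measurable_indic.
    by apply: measurable_funX; exact: measurable_dotp.
  move=> a Sa; rewrite normrM -[leRHS]mul1r ler_pM//.
    by rewrite indicE; case: (_ \in _); rewrite ?normr1 ?normr0.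
  by rewrite ger0_norm ?sqr_ge0//; exact: sphere_dotp_le.
have intT := int_sq setT measurableT.
have intW := int_sq _ mW.
rewrite -(RintegralZl 4 mS intW) -RintegralB//; last first.
  exact: (integrableZl mS 4 intW).
rewrite le_eqVlt; apply/orP; left; apply/eqP; apply: eq_Rintegral => a _.
by rewrite indicT mul1r.
Qed.

Lemma kaczmarz_proj_expectation z : close_angle theta x z ->
  (\int[mu]_a (norm2 (kaczmarz_proj x a z - x) ^+ 2)%:E
    <= ((1 - alpha / n%:R) * norm2 (z - x) ^+ 2)%:E)%E.
Proof.
move=> zx; have mS := @measurable_sphere R n; have mW := measurable_wedge x z.
have mf : measurable_fun setT (fun a => norm2 (kaczmarz_proj x a z - x) ^+ 2).
  by apply: measurable_dist2; exact: measurable_kaczmarz_proj.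
rewrite (integral_full_measure mS mu_sphere); last exact/measurable_EFinP.
set v := z - x.
pose h (a : 'cV[R]_n) := dotp a v ^+ 2 - 4 * (\1_(wedge x z) a * dotp a v ^+ 2).
have mh : measurable_fun setT h.
  have mav : measurable_fun setT (fun a : 'cV[R]_n => dotp a v ^+ 2).
    by apply: measurable_funX; exact: measurable_dotp.
  apply: measurable_funB => //; apply: measurable_funM => //.
  by apply: measurable_funM => //; exact: measurable_indic.
have inth : mu.-integrable S (EFin \o h).
  apply: (@sphere_bounded_integrable _ (5 * dotp v v)) => // a Sa.
  have := sphere_dotp_le v Sa; have := sqr_ge0 (dotp a v).
  rewrite /h indicE; case: (_ \in _) => /= h0 h1;
  rewrite ler_norml; apply/andP; split; lra.
have intc : mu.-integrable S (EFin \o cst (norm2 v ^+ 2)).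
  by apply: (@sphere_bounded_integrable _ `|norm2 v ^+ 2|).
apply: (@le_trans _ _ (\int[mu]_(a in S) (norm2 v ^+ 2 - h a)%:E)%E).
  apply: ge0_le_integral => //.
  - by move=> a _; rewrite lee_fin sqr_ge0.
  - by apply/measurable_EFinP; exact: measurable_funTS.
  - apply/measurable_EFinP/measurable_funTS.
    by apply: measurable_funB.
  - by move=> a Sa; rewrite lee_fin; exact: kaczmarz_proj_error.
have intB := integrableB mS intc inth.
rewrite -[leLHS]fineK; last exact: (integrable_fin_num mS intB).
rewrite lee_fin -/(Rintegral mu S (fun a => norm2 v ^+ 2 - h a)) RintegralB//.
rewrite Rintegral_cst//.
have -> : fine (mu S) = 1 by rewrite mu_sphere.
rewrite mulr1 mulrBl mul1r lerD2l lerN2; exact: ACW_quadratic.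
Qed.

(** An expected squared error is nonnegative: evaluate the contraction at
    [z = 2 x], which is aligned with [x] but different from it. *)
Lemma contraction_factor_ge0 : 0 <= 1 - alpha / n%:R.
Proof.
have nx : 0 < norm2 x by rewrite norm2_gt0.
have c2 : close_angle theta x (2 *: x).
  rewrite /close_angle dotpZl -norm2_sqr.
  have -> : norm2 (2 *: x) = 2 * norm2 x.
    by rewrite /norm2 !dotpE mulrA -expr2 sqrtrM ?sqr_ge0// sqrtr_sqr ger0_norm.
  rewrite -mulrA -expr2 gtr_pMl; last by rewrite mulr_gt0// exprn_gt0.
  rewrite -cos0 ltr_cos// in_itv/= ?lexx ?pi_ge0//.
  have := @pi_gt0 R; move: theta_gt0 theta_acute => ? ? ?.
  by apply/andP; split; lra.
have := kaczmarz_proj_expectation c2.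
have -> : 2 *: x - x = x by rewrite scaler_nat mulr2n addrK.
move=> /(le_trans _) h.
have {h} : (0%:E <= ((1 - alpha / n%:R) * norm2 x ^+ 2)%:E)%E.
  by apply: h; apply: integral_ge0 => a _; rewrite lee_fin sqr_ge0.
by rewrite lee_fin pmulr_lge0// exprn_gt0.
Qed.

End one_step_expectation.

(** * Recursions driven by independent inputs *)

Section markov_recursion.
Context {R : realType} {d d1 d2 : measure_display} {T : measurableType d}
  {E : measurableType d1} {A : measurableType d2} {P : probability T R}.
Variables (Phi : {mfun (E * A)%type >-> E}) (y0 : E) (mu : probability A R)
  (a : nat -> {RV P >-> A}).
Hypotheses (a_indep : mutually_independent a)
  (a_law : identically_distributed mu a).

Fixpoint recursion (k : nat) (w : T) : E :=
  if k is k'.+1 then Phi (recursion k' w, a k' w) else y0.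

Let measurable_recursion k : measurable_fun setT (recursion k).
Proof.
elim: k => [|k IH]; first exact: measurable_cst.
by apply: measurableT_comp => //; exact: measurable_fun_pair.
Qed.

HB.instance Definition _ k :=
  isMeasurableFun.Build _ _ _ _ (recursion k) (measurable_recursion k).

Definition recursion_pair k (w : T) : (E * A)%type := (recursion k w, a k w).

Let measurable_recursion_pair k : measurable_fun setT (recursion_pair k).
Proof. exact: measurable_fun_pair. Qed.

HB.instance Definition _ k :=
  isMeasurableFun.Build _ _ _ _ (recursion_pair k) (measurable_recursion_pair k).

Let measurable_preim d' (U : measurableType d') (X : {mfun T >-> U}) B :
  measurable B -> measurable (X @^-1` B).
Proof.
by move=> mB; rewrite -[X in measurable X]setTI; exact: measurable_funP.
Qed.

(** The state at time [k] is a function of [a_0, ..., a_(k-1)], hence independent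
    of the later inputs. By induction on [k]: with [D] an event about inputs of
    index at least [k + 1], the induction hypothesis, applied with one more
    input, says that [X |-> P (pair k in X, D)] and [X |-> P D * P (pair k in X)]
    agree on rectangles, hence on all measurable [X], in particular on preimages
    under [Phi]. *)
Lemma recursion_independent_tail k (J : seq nat) (C : nat -> set A) (B : set E) :
  uniq J -> (forall j, j \in J -> (k <= j)%N) ->
  (forall j, measurable (C j)) -> measurable B ->
  P (recursion k @^-1` B `&` \bigcap_(j in [set` J]) (a j @^-1` C j)) =
  (P (recursion k @^-1` B) * \prod_(j <- J) P (a j @^-1` C j))%E.
Proof.
elim: k J C B => [|k IH] J C B uJ kJ mC mB.
  have [By|By] := pselect (B y0).
    have -> : recursion 0 @^-1` B = setT by apply/seteqP; split.
    by rewrite setTI probability_setT mul1e a_indep.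
  have -> : recursion 0 @^-1` B = set0 by apply/seteqP; split.
  by rewrite set0I measure0 mul0e.
set D := \bigcap_(j in [set` J]) (a j @^-1` C j).
have mD : measurable D.
  by apply: fin_bigcap_measurable => // j _; exact: measurable_preim.
have PD : P D = (\prod_(j <- J) P (a j @^-1` C j))%E by rewrite a_indep.
rewrite -PD; have pD0 : 0 <= fine (P D) by rewrite fine_ge0.
pose p := NngNum pD0.
pose G := [set X : set (E * A)%type | exists B' C',
  [/\ measurable B', measurable C' & X = B' `*` C']].
suff H : forall X : set (E * A)%type, measurable X ->
    P (recursion_pair k @^-1` X `&` D) =
    (p%:num%:E * P (recursion_pair k @^-1` X))%E.
  have -> : recursion k.+1 @^-1` B = recursion_pair k @^-1` (Phi @^-1` B) by [].
  rewrite H; last by rewrite -[X in measurable X]setTI; exact: measurable_funP.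
  by rewrite fineK ?fin_num_measure// muleC.
move=> X mX.
unshelve apply: (measure_unique G (fun=> setT) _ _ _ _
  (pushforward (mrestr P mD) (recursion_pair k))
  (mscale p (distribution P (recursion_pair k))) _ _ X mX) => //.
- rewrite measurable_prod_measurableType; congr (<<s _ >>).
  apply/seteqP; split=> [Y [B' mB' [C' mC' <-]]|Y [B' [C' [mB' mC' ->]]]].
    by exists B', C'.
  by exists B' => //; exists C'.
- move=> _ _ [B1 [C1 [mB1 mC1 ->]]] [B2 [C2 [mB2 mC2 ->]]].
  by exists (B1 `&` B2), (C1 `&` C2); split; [exact: measurableI..|rewrite setXI].
- by move=> _; exists setT, setT; split => //; rewrite setXTT.
- by rewrite bigcup_const//; exists 0%N.
- move=> _ [B' [C' [mB' mC' ->]]].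
  change (P (recursion_pair k @^-1` (B' `*` C') `&` D) =
    (p%:num%:E * P (recursion_pair k @^-1` (B' `*` C')))%E).
  have kJ' : k \notin J by apply/negP => /kJ; rewrite ltnn.
  pose C2 j := if j == k then C' else C j.
  have mC2 j : measurable (C2 j) by rewrite /C2; case: ifP.
  have C2J j : j \in J -> C2 j = C j.
    by rewrite /C2; case: eqVneq => // -> kJ2; rewrite kJ2 in kJ'.
  have C2k : C2 k = C' by rewrite /C2 eqxx.
  have -> : recursion_pair k @^-1` (B' `*` C') =
      recursion k @^-1` B' `&` a k @^-1` C' by [].
  rewrite -setIA.
  have -> : a k @^-1` C' `&` D = \bigcap_(j in [set` k :: J]) (a j @^-1` C2 j).
    rewrite bigcap_seq big_cons C2k -bigcap_seq; congr (_ `&` _).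
    by apply: eq_bigcapr => j /= jJ; rewrite C2J.
  have -> : a k @^-1` C' = \bigcap_(j in [set` [:: k]]) (a j @^-1` C2 j).
    by rewrite set_cons1 bigcap_set1 C2k.
  rewrite (IH (k :: J))//; last 2 first.
  + by rewrite /= kJ'.
  + by move=> j; rewrite inE => /orP[/eqP -> //|/kJ]; exact: ltnW.
  rewrite (IH [:: k])//; last by move=> j; rewrite inE => /eqP ->.
  rewrite big_cons big_seq1 muleA muleC; congr (_ * _)%E.
  rewrite fineK ?fin_num_measure// PD.
  by rewrite big_seq [RHS]big_seq; apply: eq_bigr => j jJ; rewrite C2J.
- move=> _; change (P (recursion_pair k @^-1` setT `&` D) < +oo)%E.
  by rewrite preimage_setT setTI -ge0_fin_numE// fin_num_measure.
Qed.

(** By independence, the joint law of the state at time [k] and of [a_k] is a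
    product measure, to which the Tonelli theorem applies. *)
Lemma ge0_integral_recursion k (f : (E * A)%type -> \bar R) :
  measurable_fun [set: E * A] f -> (forall z, 0 <= f z)%E ->
  (\int[P]_w f (recursion k w, a k w) =
   \int[P]_w \int[mu]_z f (recursion k w, z))%E.
Proof.
move=> mf f0.
rewrite -(@ge0_integral_distribution _ _ _ _ _ P (recursion_pair k))//.
rewrite -(@ge0_integral_distribution _ _ _ _ _ P (recursion k)
  (fun y => \int[mu]_z f (y, z))%E)//; last 2 first.
- exact: measurable_fun_fubini_tonelli_F.
- by move=> y; exact: integral_ge0.
rewrite -fubini_tonelli1//.
apply: eq_measure_integral => X mX _; symmetry.
apply: product_measure_unique => // B C mB mC.
have := @recursion_independent_tail k [:: k] (fun=> C) B.
rewrite set_cons1 bigcap_set1 big_seq1.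
have -> : P (a k @^-1` C) = mu C := a_law k mC.
by apply=> // j; rewrite inE => /eqP ->.
Qed.

End markov_recursion.

(** * The process stopped on leaving the cone *)

Lemma integral_probability_cst {R : realType} {d} {T : measurableType d}
    (P : probability T R) (r : R) : (\int[P]_t r%:E = r%:E)%E.
Proof. by have := expectation_cst P r; rewrite unlock. Qed.

Section stopped_process.
Context {R : realType} {n : nat}.
Variables (theta : R) (x : 'cV[R]_n).

(** A Kaczmarz step that is performed only inside the cone, so that its iterates
    are the Kaczmarz process stopped on leaving the cone. Being stopped is thus
    visible in the current position alone, and the stopped process is again of
    the form [Y_(k+1) = Phi (Y_k, a_k)]. *)
Definition stopped_step (p : 'cV[R]_n * 'cV[R]_n) : 'cV[R]_n :=
  if close_angle theta x p.1 then kaczmarz_proj x p.2 p.1 else p.1.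

Let measurable_stopped_step : measurable_fun setT stopped_step.
Proof.
apply: measurable_fun_ifT => //; first exact: measurable_close_angle.
exact: measurable_kaczmarz_proj.
Qed.

HB.instance Definition _ :=
  isMeasurableFun.Build _ _ _ _ stopped_step measurable_stopped_step.

Context {d : measure_display} {T : measurableType d} {P : probability T R}.
Variables (x0 : 'cV[R]_n) (a : nat -> {RV P >-> 'cV[R]_n}).

Local Notation stopped := (recursion stopped_step x0 a).

Lemma stopped_kaczmarz k w :
  (forall j, (j < k)%N -> close_angle theta x (stopped j w)) ->
  stopped k w = kaczmarz x x0 a k w.
Proof.
elim: k => //= k IH cl.
by rewrite /stopped_step /= cl// IH// => j jk; apply: cl; exact: ltnW.
Qed.

Lemma stopped_closeS k w :
  close_angle theta x (stopped k.+1 w) -> close_angle theta x (stopped k w).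
Proof. by rewrite /= /stopped_step/=; case: ifPn => // /negbTE ->. Qed.

Lemma stopped_close_le j k w : (j <= k)%N ->
  close_angle theta x (stopped k w) -> close_angle theta x (stopped j w).
Proof.
elim: k => [|k IH]; first by rewrite leqn0 => /eqP ->.
by rewrite leq_eqVlt => /orP[/eqP ->//|jk] /stopped_closeS; exact: IH.
Qed.

Lemma close_stoppedE w :
  (forall k, close_angle theta x (kaczmarz x x0 a k w)) <->
  (forall k, close_angle theta x (stopped k w)).
Proof.
split=> cl k; last by rewrite -stopped_kaczmarz// => j _; exact: cl.
suff : stopped k w = kaczmarz x x0 a k w by move=> ->.
elim: k => [//|k IH]; apply: stopped_kaczmarz => j jk.
by apply: (@stopped_close_le _ k); rewrite // IH.
Qed.

(** Once stopped, the process never re-enters the cone: this is the event that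
    it has left the cone by time [k]. *)
Definition escape (k : nat) : set T :=
  [set w | ~~ close_angle theta x (stopped k w)].

Lemma measurable_escape k : measurable (escape k).
Proof.
have -> : escape k = setT `&`
    (fun w => close_angle theta x (stopped k w)) @^-1` [set false].
  by rewrite setTI; apply/seteqP; split=> w;
    rewrite /escape/=; [move/negbTE|move=> ->].
exact: (measurable_close_angle theta x (measurable_funPT (stopped k))).
Qed.

Definition sq_error (k : nat) (w : T) : R := norm2 (stopped k w - x) ^+ 2.

Lemma measurable_sq_error k : measurable_fun setT (sq_error k).
Proof. exact: measurable_dist2. Qed.

Lemma sq_error_ge0 k w : 0 <= sq_error k w.
Proof. exact: sqr_ge0. Qed.

Lemma measurable_alive_sq_error k :
  measurable_fun setT (fun w => sq_error k w * \1_(~` escape k) w).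
Proof.
apply: measurable_funM; first exact: measurable_sq_error.
by apply: measurable_indic; apply: measurableC; exact: measurable_escape.
Qed.

Variables (mu : probability 'cV[R]_n R) (alpha : R).
Hypotheses (alpha_gt0 : 0 < alpha) (theta_gt0 : 0 < theta)
  (theta_acute : theta < pi / 2) (mu_sphere : mu (sphere n) = 1%E)
  (mu_ACW : ACW mu theta alpha) (x_neq0 : x != 0)
  (a_indep : mutually_independent a) (a_law : identically_distributed mu a).

Let c := 1 - alpha / n%:R.
Let dist2 (y : 'cV[R]_n) := norm2 (y - x) ^+ 2.

Let c_ge0 : 0 <= c.
Proof.
exact (contraction_factor_ge0 mu_sphere theta_gt0 theta_acute mu_ACW
  x_neq0).
Qed.

Let c_le1 : c <= 1.
Proof. by rewrite gerBl divr_ge0// ltW. Qed.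

Let measurable_next :
  measurable_fun [set: 'cV[R]_n * 'cV[R]_n] (fun p => dist2 (stopped_step p)).
Proof. by apply: measurable_dist2. Qed.

(** Supermartingale property: inside the cone a step contracts the squared error
    on average, outside of it nothing moves. *)
Lemma expected_sq_errorS k :
  (\int[P]_w (sq_error k.+1 w)%:E <= \int[P]_w (sq_error k w)%:E)%E.
Proof.
rewrite (ge0_integral_recursion stopped_step x0 a_indep a_law k
  (f := fun p => (dist2 (stopped_step p))%:E)); last 2 first.
- exact/measurable_EFinP.
- by move=> p; rewrite lee_fin sqr_ge0.
apply: ge0_le_integral => //.
- by move=> w _; apply: integral_ge0 => v _; rewrite lee_fin sqr_ge0.
- apply: (@measurableT_comp _ _ _ _ _ _
    (fun y => \int[mu]_v (dist2 (stopped_step (y, v)))%:E)%E) => //.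
  apply: (measurable_fun_fubini_tonelli_F
    (fun p => (dist2 (stopped_step p))%:E)).
    exact/measurable_EFinP.
  by move=> p; rewrite lee_fin sqr_ge0.
- by apply/measurable_EFinP; exact: measurable_sq_error.
move=> w _; rewrite /sq_error /=; move: (stopped k w) => y.
rewrite /stopped_step /=; case: (boolP (close_angle theta x y)) => [cl|_].
  apply: le_trans (kaczmarz_proj_expectation mu_sphere theta_gt0 theta_acute
    mu_ACW x_neq0 cl) _.
  by rewrite lee_fin ler_piMl// sqr_ge0.
by rewrite integral_probability_cst.
Qed.

Lemma expected_sq_error_le k :
  (\int[P]_w (sq_error k w)%:E <= (norm2 (x0 - x) ^+ 2)%:E)%E.
Proof.
elim: k => [|k]; last exact/le_trans/expected_sq_errorS.
by rewrite (integral_probability_cst P (norm2 (x0 - x) ^+ 2)).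
Qed.

(** A path in the cone at time [k + 1] was in the cone at time [k], so the
    indicator of the latter, which does not depend on [a_k], may replace that of
    the former before averaging over [a_k]. *)
Lemma alive_sq_errorS k :
  (\int[P]_w (sq_error k.+1 w * \1_(~` escape k.+1) w)%:E <=
   c%:E * \int[P]_w (sq_error k w * \1_(~` escape k) w)%:E)%E.
Proof.
pose g (p : 'cV[R]_n * 'cV[R]_n) :=
  dist2 (stopped_step p) * (close_angle theta x p.1)%:R.
have mg : measurable_fun [set: 'cV[R]_n * 'cV[R]_n] g.
  apply: measurable_funM => //.
  have -> : (fun p : 'cV[R]_n * 'cV[R]_n => (close_angle theta x p.1)%:R) =
      (fun p => if close_angle theta x p.1 then 1 else 0 : R).
    by apply/funext => p; case: ifP.
  by apply: measurable_fun_ifT => //; exact: measurable_close_angle.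
have g0 p : 0 <= g p by rewrite mulr_ge0 ?sqr_ge0.
have mclose : measurable_fun setT
    (fun w => sq_error k.+1 w * (close_angle theta x (stopped k w))%:R).
  exact: (measurableT_comp mg (measurable_fun_pair
    (measurable_funPT (stopped k)) (measurable_funPT (a k)))).
apply: (@le_trans _ _ (\int[P]_w
    (sq_error k.+1 w * (close_angle theta x (stopped k w))%:R)%:E)%E).
  apply: ge0_le_integral => //.
  - by move=> w _; rewrite lee_fin mulr_ge0 ?sq_error_ge0.
  - by apply/measurable_EFinP; exact: measurable_alive_sq_error.
  - exact/measurable_EFinP.
  - move=> w _; rewrite lee_fin ler_wpM2l ?sq_error_ge0// indicE ler_nat.
    case: (boolP (close_angle theta x (stopped k w))) => [_|nc].
      by case: (_ \in _).
    rewrite memNset//; apply; rewrite /escape/=.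
    by apply: contra nc; exact: stopped_closeS.
rewrite (ge0_integral_recursion stopped_step x0 a_indep a_law k
  (f := fun p => (g p)%:E)); last 2 first.
- exact/measurable_EFinP.
- by move=> p; rewrite lee_fin.
rewrite -ge0_integralZl_EFin//; last 2 first.
- by move=> w _; rewrite lee_fin mulr_ge0 ?sq_error_ge0.
- by apply/measurable_EFinP; exact: measurable_alive_sq_error.
apply: ge0_le_integral => //.
- by move=> w _; apply: integral_ge0 => v _; rewrite lee_fin.
- apply: (@measurableT_comp _ _ _ _ _ _
    (fun y => \int[mu]_v (g (y, v))%:E)%E) => //.
  apply: (measurable_fun_fubini_tonelli_F (fun p => (g p)%:E)).
    exact/measurable_EFinP.
  by move=> p; rewrite lee_fin.
- apply: measurable_funeM; apply/measurable_EFinP.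
  exact: measurable_alive_sq_error.
move=> w _; have -> : \1_(~` escape k) w =
    (close_angle theta x (stopped k w))%:R :> R.
  rewrite indicE; congr ((nat_of_bool _)%:R).
  apply/idP/idP; rewrite in_setE /escape/=.
    by move/negP; rewrite negbK.
  by move=> cl; apply/negP; rewrite negbK.
rewrite /g /sq_error /=; move: (stopped k w) => y.
rewrite /stopped_step /=; case: (boolP (close_angle theta x y)) => [cl|ncl].
  under eq_integral do rewrite mulr1.
  rewrite mulr1 -EFinM.
  exact: (kaczmarz_proj_expectation mu_sphere theta_gt0 theta_acute
    mu_ACW x_neq0 cl).
under eq_integral do rewrite mulr0.
by rewrite integral0 mulr0 mule0.
Qed.

Lemma alive_sq_error_le k :
  (\int[P]_w (sq_error k w * \1_(~` escape k) w)%:E <=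
   (c ^+ k * norm2 (x0 - x) ^+ 2)%:E)%E.
Proof.
elim: k => [|k IH].
  rewrite expr0 mul1r; apply: le_trans (expected_sq_error_le 0).
  apply: ge0_le_integral => //.
  - by move=> w _; rewrite lee_fin mulr_ge0 ?sq_error_ge0.
  - by apply/measurable_EFinP; exact: measurable_alive_sq_error.
  - by apply/measurable_EFinP; exact: measurable_sq_error.
  - by move=> w _; rewrite lee_fin ler_piMr ?sq_error_ge0.
apply: le_trans (alive_sq_errorS k) _.
by rewrite exprS -mulrA EFinM lee_wpmul2l// lee_fin.
Qed.

(** Markov inequality for the squared error of the stopped process, which is at
    least [(|x| sin theta)^2] outside of the cone. *)
Lemma escape_probability_le k : 0 < sin theta ->
  (P (escape k) <= (norm2 (x0 - x) ^+ 2 / (norm2 x * sin theta) ^+ 2)%:E)%E.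
Proof.
move=> st; set s := (norm2 x * sin theta) ^+ 2.
have s0 : 0 < s by rewrite exprn_gt0// mulr_gt0// norm2_gt0.
have mE := measurable_escape k.
have : (s%:E * P (escape k) <= (norm2 (x0 - x) ^+ 2)%:E)%E.
  apply: le_trans (expected_sq_error_le k).
  rewrite -[X in (_ * P X)%E]setIT -(integral_indic P measurableT mE).
  rewrite -ge0_integralZl_EFin//; [|exact/measurable_EFinP|exact: ltW].
  apply: ge0_le_integral => //.
  - by move=> w _; rewrite -EFinM lee_fin mulr_ge0// ltW.
  - by apply: measurable_funeM; apply/measurable_EFinP.
  - by apply/measurable_EFinP; exact: measurable_sq_error.
  - move=> w _; rewrite -EFinM lee_fin indicE.
    have [we|we] := pselect (escape k w).
      by rewrite mem_set// mulr1; exact: not_close_dist.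
    by rewrite memNset// mulr0 sq_error_ge0.
rewrite -(fineK (fin_num_measure P _ mE)) -EFinM !lee_fin => h.
by rewrite ler_pdivlMr// mulrC.
Qed.

End stopped_process.

(** * Convergence and escape probability *)

Theorem theorem4p3 (R : realType) (n : nat) (alpha theta : R)
    (mu : probability 'cV[R]_n R) (x x0 : 'cV[R]_n) (delta : R)
    (d : measure_display) (T : measurableType d) (P : probability T R)
    (a : nat -> {RV P >-> 'cV[R]_n})
    (alpha_gt0 : 0 < alpha)
    (theta_gt0 : 0 < theta) (theta_acute : theta < pi / 2)
    (mu_sphere : mu (sphere n) = 1%E)
    (mu_ACW : ACW mu theta alpha)
    (x_neq0 : x != 0) (delta_gt0 : 0 < delta)
    (x0_close : norm2 (x0 - x) <= delta * norm2 x)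
    (a_indep : mutually_independent a)
    (a_law : identically_distributed mu a) :
  let X : nat -> T -> 'cV[R]_n := kaczmarz x x0 a in
  let Omega : set T := [set w | forall k : nat, makes_angle_lt theta (X k w) x] in
  (forall k : nat,
     ('E_P[(fun w => norm2 (X k w - x) ^+ 2 * \1_Omega w)%R]
       <= ((1 - alpha / n%:R) ^+ k * norm2 (x0 - x) ^+ 2)%:E)%E) /\
  (P (~` Omega) <= ((delta / sin theta) ^+ 2)%:E)%E.
Proof.
move=> X Omega.
pose Y := recursion (stopped_step theta x) x0 a.
pose esc := escape theta x x0 a.
have OmegaE w : Omega w <-> forall k, close_angle theta x (Y k w).
  apply: iff_trans (close_stoppedE theta x x0 a w).
  by split=> cl k; have /(makes_angle_ltE _ theta_gt0 theta_acute x_neq0) := cl k.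
have OmegaC : ~` Omega = \bigcup_k esc k.
  apply/seteqP; split=> [w /OmegaE/existsNP[k /negP nc]|w [k _ nc] /OmegaE cl].
    by exists k.
  by move: nc; rewrite /esc /escape/= cl.
have mesc k : measurable (esc k) by exact: measurable_escape.
have mOmegaC : measurable (~` Omega) by rewrite OmegaC; exact: bigcupT_measurable.
have mOmega : measurable Omega by rewrite -(setCK Omega); exact: measurableC.
split=> [k|].
  rewrite unlock.
  have -> : (fun w => (norm2 (X k w - x) ^+ 2 * \1_Omega w)%:E) =
      (fun w => (sq_error theta x x0 a k w * \1_Omega w)%:E).
    apply/funext => w; rewrite indicE; case: (boolP (w \in Omega)); last first.
      by rewrite !mulr0.
    by rewrite in_setE => /OmegaE cl; rewrite /sq_error stopped_kaczmarz.
  apply: le_trans (alive_sq_error_le x0 alpha_gt0 theta_gt0 theta_acute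
    mu_sphere mu_ACW x_neq0 a_indep a_law k).
  apply: ge0_le_integral => //.
  - by move=> w _; rewrite lee_fin mulr_ge0 ?sq_error_ge0.
  - apply/measurable_EFinP/measurable_funM; first exact: measurable_sq_error.
    exact: measurable_indic.
  - by apply/measurable_EFinP; exact: measurable_alive_sq_error.
  - move=> w _; rewrite lee_fin ler_wpM2l ?sq_error_ge0//.
    have [Ow|nO] := pselect (Omega w); last by rewrite indicE memNset.
    rewrite !indicE !mem_set//=; move/OmegaE : Ow => /(_ k) cl.
    by rewrite /escape/=; apply/negP; rewrite negbK.
have st : 0 < sin theta.
  by apply: sin_gt0_pi; rewrite theta_gt0/=; have := @pi_gt0 R; lra.
have nx : 0 < norm2 x by rewrite norm2_gt0.
have ndesc : {homo esc : i j / (i <= j)%N >-> (i <= j)%O}.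
  move=> i j ij; apply/subsetPset => w; rewrite /esc /escape/=.
  by apply: contra; exact: stopped_close_le.
rewrite OmegaC.
have cv := nondecreasing_cvg_mu (mu := P) mesc (bigcupT_measurable esc mesc) ndesc.
rewrite -(cvg_lim _ cv)//.
apply: lime_le; first by apply/cvg_ex; exists (P (\bigcup_k esc k)).
apply: nearW => k; apply: le_trans (escape_probability_le x0 alpha_gt0 theta_gt0
  theta_acute mu_sphere mu_ACW x_neq0 a_indep a_law k st) _.
rewrite lee_fin ler_pdivrMr; last by rewrite exprn_gt0// mulr_gt0.
have -> : (delta / sin theta) ^+ 2 * (norm2 x * sin theta) ^+ 2 =
    (delta * norm2 x) ^+ 2 by field; rewrite gt_eqF.
by rewrite ler_sqr// nnegrE ?norm2_ge0// mulr_ge0// ltW.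
Qed.
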